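(* Let $\alpha\geq 0$, $\beta\geq 0$, and let $g\in H(\mathbb D)$ be such that $g'$ has no zeros in $\mathbb D$ and an analytic branch of $\log(g')$ belongs to the Bloch space $\mathcal B$. Then $T_g: H^{\infty}_\alpha\rightarrow H^{\infty}_\beta$ is bounded if and only if $$\limsup_{t\rightarrow1^-}\sup_{0\leq\theta<2\pi}(1-t^2)^\beta\int_0^t\frac{|g'(re^{i\theta})|}{(1-r^2)^\alpha}\,dr<+\infty\,.$$
   Context: $\mathbb D$ is the open unit disk and $H(\mathbb D)$ the space of analytic functions on $\mathbb D$. For $\alpha\geq0$, $H^{\infty}_\alpha=\{f\in H(\mathbb D): \|f\|_{H^\infty_\alpha}:=\sup_{z\in\mathbb D}(1-|z|^2)^\alpha|f(z)|<\infty\}$. The Bloch space is $\mathcal B=\{f\in H(\mathbb D): |f(0)|+\sup_{z\in\mathbb D}(1-|z|^2)|f'(z)|<\infty\}$. For $g\in H(\mathbb D)$, the Volterra type operator is $(T_gf)(z)=\int_0^z f(\omega)g'(\omega)\,d\omega$ for $f\in H(\mathbb D)$, $z\in\mathbb D$. *)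

(* Defs.v *)
From Stdlib Require Import Reals.
Open Scope R_scope.

Definition Cx : Type := (R * R)%type.
Definition Cre (z : Cx) : R := fst z.
Definition Cim (z : Cx) : R := snd z.
Definition C0 : Cx := (0, 0).
Definition Cadd (z w : Cx) : Cx := (fst z + fst w, snd z + snd w).
Definition Csub (z w : Cx) : Cx := (fst z - fst w, snd z - snd w).
Definition Cmul (z w : Cx) : Cx :=
  (fst z * fst w - snd z * snd w, fst z * snd w + snd z * fst w).
Definition Cscal (r : R) (z : Cx) : Cx := (r * fst z, r * snd z).
Definition Cmod (z : Cx) : R := sqrt (fst z ^ 2 + snd z ^ 2).
Definition Cexp (z : Cx) : Cx := (exp (fst z) * cos (snd z), exp (fst z) * sin (snd z)).
Definition polar (r theta : R) : Cx := (r * cos theta, r * sin theta).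

Definition inD (z : Cx) : Prop := Cmod z < 1.

Definition cderiv_at (f : Cx -> Cx) (z l : Cx) : Prop :=
  forall eps : R, 0 < eps -> exists del : R, 0 < del /\
    forall w : Cx, 0 < Cmod (Csub w z) < del ->
      Cmod (Csub (Csub (f w) (f z)) (Cmul l (Csub w z))) <= eps * Cmod (Csub w z).

Definition is_deriv_on_D (f df : Cx -> Cx) : Prop :=
  forall z : Cx, inD z -> cderiv_at f z (df z).

Definition holoD (f : Cx -> Cx) : Prop := exists df : Cx -> Cx, is_deriv_on_D f df.

Definition wgt (a : R) (z : Cx) : R := Rpower (1 - Cmod z ^ 2) a.

Definition in_Bloch (h : Cx -> Cx) : Prop :=
  exists dh : Cx -> Cx, is_deriv_on_D h dh /\
    exists K : R, forall z : Cx, inD z -> (1 - Cmod z ^ 2) * Cmod (dh z) <= K.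

Definition integral_eq (f : R -> R) (a b I : R) : Prop :=
  exists pr : Riemann_integrable f a b, RiemannInt pr = I.

(* w = (T_g f)(z) = int_0^z f(om) g'(om) d om, computed along the segment
   om = s z, s in [0,1]:  int_0^1 f(s z) g'(s z) z ds (real and imaginary parts). *)
Definition Tg_value (dg f : Cx -> Cx) (z w : Cx) : Prop :=
  integral_eq (fun s => Cre (Cmul (Cmul (f (Cscal s z)) (dg (Cscal s z))) z)) 0 1 (Cre w) /\
  integral_eq (fun s => Cim (Cmul (Cmul (f (Cscal s z)) (dg (Cscal s z))) z)) 0 1 (Cim w).

(* T_g : H^inf_alpha -> H^inf_beta is bounded:
   ||T_g f||_beta <= K ||f||_alpha for all f in H^inf_alpha
   (stated with an arbitrary bound M >= ||f||_alpha). *)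
Definition Tg_bounded (dg : Cx -> Cx) (alpha beta : R) : Prop :=
  exists K : R, 0 <= K /\
    forall (f : Cx -> Cx) (M : R), holoD f ->
      (forall z : Cx, inD z -> wgt alpha z * Cmod (f z) <= M) ->
      forall z w : Cx, inD z -> Tg_value dg f z w -> wgt beta z * Cmod w <= K * M.

Definition limsup_cond (dg : Cx -> Cx) (alpha beta : R) : Prop :=
  exists M t0 : R, 0 <= t0 < 1 /\
    forall t theta : R, t0 < t < 1 -> 0 <= theta < 2 * PI ->
      forall I : R,
        integral_eq (fun r => Cmod (dg (polar r theta)) / Rpower (1 - r ^ 2) alpha) 0 t I ->
        Rpower (1 - t ^ 2) beta * I <= M.

(* Main.v *)
(* Boundedness from the integral condition is the triangle inequality along the radius to z.

   Conversely, fix a radius with direction e = exp(i theta) and write psi(r) = Im (log g')(r e).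
   Since log g' is a Bloch function, psi is Lipschitz with respect to the hyperbolic coordinate
   x(r) = log((1+r)/(1-r)), uniformly in theta. With zeta = z / e and
   W = log(1+zeta) - log(1-zeta), put
     f(z) = (1-zeta)^(-alpha) sum_{n <= N} exp(-i psi(r_n)) exp(-8 (L W - n)^2),  x(r_n) = n/L.
   Because |Im W| < PI on the disk, every Gaussian is at most a constant times its value at
   Re W, so f is bounded in H^infty_alpha independently of theta and N. On the radius W = x(r),
   and f is a smoothed version of (1-r)^(-alpha) exp(-i psi(r)): the nearest node dominates the
   sum, the nodes at distance at most 1 contribute with cosine at least 1/2, and the remaining
   ones are negligible. Hence Re (f g') >= c |g'| (1-r^2)^(-alpha) there, and testing T_g on f
   bounds the integral. *)
From Stdlib Require Import Lra IndefiniteDescription.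
From Coquelicot Require Import Coquelicot.
Require Import Defs.
From Stdlib Require Import Reals.
Open Scope R_scope.

(** * Complex derivatives *)

(** Bridge to Coquelicot, from which the algebraic rules and the chain rule are then inherited. The
    only discrepancy is the point [w = z], excluded in [cderiv_at]; there both sides of the estimate
    vanish. *)
Lemma cderiv_is_derive (f : Cx -> Cx) (z l : Cx) :
  cderiv_at f z l <->
  @is_derive C_AbsRing (AbsRing_NormedModule C_AbsRing) f z l.
Proof.
split.
- intros H; split; [apply (is_linear_scal_l (K := C_AbsRing)) |].
  intros x Hx.
  assert (E : z = x) by exact (is_filter_lim_locally_unique
    (V := AbsRing_NormedModule C_AbsRing) z x Hx).
  subst x.
  intros eps; destruct (H eps (cond_pos eps)) as [d [Hd H1]].
  exists (mkposreal d Hd); intros w Hw.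
  change (Cmod (Csub w z) < d) in Hw.
  change (Cmod (Csub (Csub (f w) (f z)) (Cmul (Csub w z) l))
          <= eps * Cmod (Csub w z)).
  replace (Cmul (Csub w z) l) with (Cmul l (Csub w z))
    by (unfold Cmul; f_equal; ring).
  destruct (Cmod_ge_0 (Csub w z)) as [H0 | H0].
  + apply H1; split; [exact H0 | exact Hw].
  + assert (E : Csub w z = C0) by exact (Cmod_eq_0 _ (eq_sym H0)).
    assert (Ew : w = z).
    { destruct w, z; injection E; intros; f_equal; lra. }
    subst w; rewrite E.
    replace (Csub (Csub (f z) (f z)) (Cmul l C0)) with C0
      by (unfold C0, Csub, Cmul; simpl; f_equal; ring).
    replace (Cmod C0) with 0 by exact (eq_sym Cmod_0). lra.
- intros [_ H] eps Heps.
  destruct (H z (fun P HP => HP) (mkposreal eps Heps)) as [d Hd].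
  exists d; split; [apply cond_pos |].
  intros w [_ Hw]. specialize (Hd w Hw).
  change (Cmod (Csub (Csub (f w) (f z)) (Cmul (Csub w z) l))
          <= eps * Cmod (Csub w z)) in Hd.
  replace (Cmul l (Csub w z)) with (Cmul (Csub w z) l)
    by (unfold Cmul; f_equal; ring).
  exact Hd.
Qed.

Lemma cderiv_add (f g : Cx -> Cx) (z l m : Cx) :
  cderiv_at f z l -> cderiv_at g z m ->
  cderiv_at (fun w => Cadd (f w) (g w)) z (Cadd l m).
Proof.
rewrite !cderiv_is_derive.
exact (is_derive_plus (K := C_AbsRing) (V := AbsRing_NormedModule C_AbsRing) f g z l m).
Qed.

Lemma cderiv_sub (f g : Cx -> Cx) (z l m : Cx) :
  cderiv_at f z l -> cderiv_at g z m ->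
  cderiv_at (fun w => Csub (f w) (g w)) z (Csub l m).
Proof.
rewrite !cderiv_is_derive.
exact (is_derive_minus (K := C_AbsRing) (V := AbsRing_NormedModule C_AbsRing) f g z l m).
Qed.

Lemma cderiv_mul (f g : Cx -> Cx) (z l m : Cx) :
  cderiv_at f z l -> cderiv_at g z m ->
  cderiv_at (fun w => Cmul (f w) (g w)) z (Cadd (Cmul l (g z)) (Cmul (f z) m)).
Proof.
rewrite !cderiv_is_derive; intros Hf Hg.
exact (is_derive_mult (K := C_AbsRing) f g z l m Hf Hg Cmult_comm).
Qed.

Lemma cderiv_comp (f g : Cx -> Cx) (z l m : Cx) :
  cderiv_at f (g z) l -> cderiv_at g z m ->
  cderiv_at (fun w => f (g w)) z (Cmul m l).
Proof.
rewrite !cderiv_is_derive.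
exact (is_derive_comp (K := C_AbsRing) (V := AbsRing_NormedModule C_AbsRing) f g z l m).
Qed.

Lemma cderiv_const (c z : Cx) : cderiv_at (fun _ => c) z C0.
Proof.
rewrite cderiv_is_derive.
exact (is_derive_const (K := C_AbsRing) (V := AbsRing_NormedModule C_AbsRing) c z).
Qed.

Lemma cderiv_id (z : Cx) : cderiv_at (fun w => w) z (1, 0).
Proof. rewrite cderiv_is_derive. exact (is_derive_id (K := C_AbsRing) z). Qed.

(** Real differentiability together with the Cauchy-Riemann equations gives a complex derivative.
    Each coordinate is allowed an error [eps / 2], and the modulus is at most the sum of the
    absolute coordinates. *)
Lemma cderiv_of_partials (f : Cx -> Cx) (z : Cx) (a b : R) :
  differentiable_pt_lim (fun x y => fst (f (x, y))) (fst z) (snd z) a (- b) ->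
  differentiable_pt_lim (fun x y => snd (f (x, y))) (fst z) (snd z) b a ->
  cderiv_at f z (a, b).
Proof.
intros Hu Hv eps Heps.
assert (H2 : 0 < eps / 2) by lra.
destruct (Hu (mkposreal _ H2)) as [d1 H1].
destruct (Hv (mkposreal _ H2)) as [d2 Hd2].
exists (Rmin d1 d2); split; [apply Rmin_pos; apply cond_pos |].
intros w [_ Hw].
assert (M := Rmax_Cmod (Csub w z)).
change (Complex.Cmod (Csub w z)) with (Cmod (Csub w z)) in M.
assert (Ml := Rmax_l (Rabs (fst (Csub w z))) (Rabs (snd (Csub w z)))).
assert (Mr := Rmax_r (Rabs (fst (Csub w z))) (Rabs (snd (Csub w z)))).
assert (m1 := Rmin_l d1 d2); assert (m2 := Rmin_r d1 d2).
destruct w as [x y], z as [x0 y0]; simpl in *.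
specialize (H1 x y ltac:(lra) ltac:(lra)).
specialize (Hd2 x y ltac:(lra) ltac:(lra)).
set (p := Csub (Csub (f (x, y)) (f (x0, y0))) (Cmul (a, b) (Csub (x, y) (x0, y0)))).
assert (Hp : Cmod p <= Rabs (fst p) + Rabs (snd p)).
{ unfold Cmod. rewrite <- (sqrt_Rsqr (Rabs (fst p) + Rabs (snd p)))
    by (assert (A := Rabs_pos (fst p)); assert (B := Rabs_pos (snd p)); lra).
  apply sqrt_le_1_alt; unfold Rsqr.
  rewrite <- (pow2_abs (fst p)), <- (pow2_abs (snd p)).
  assert (A := Rabs_pos (fst p)); assert (B := Rabs_pos (snd p)); nra. }
replace (fst p) with (fst (f (x, y)) - fst (f (x0, y0)) - (a * (x - x0) + - b * (y - y0))) in Hp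
  by (unfold p; simpl; ring).
replace (snd p) with (snd (f (x, y)) - snd (f (x0, y0)) - (b * (x - x0) + a * (y - y0))) in Hp
  by (unfold p; simpl; ring).
nra.
Qed.

Lemma differentiable_pt_lim_comp1 (F : R -> R) (f : R -> R -> R) (x y lx ly l : R) :
  derivable_pt_lim F (f x y) l -> differentiable_pt_lim f x y lx ly ->
  differentiable_pt_lim (fun u v => F (f u v)) x y (l * lx) (l * ly).
Proof.
intros HF Hf.
replace (l * lx) with (l * lx + 0 * lx) by ring.
replace (l * ly) with (l * ly + 0 * ly) by ring.
exact (differentiable_pt_lim_comp (fun u _ => F u) f f x y l 0 lx ly lx ly
  (differentiable_pt_lim_proj1_0 F (f x y) (f x y) l HF) Hf Hf).
Qed.

Lemma differentiable_pt_lim_fst (x y : R) :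
  differentiable_pt_lim (fun u _ => u) x y 1 0.
Proof. exact (differentiable_pt_lim_proj1_0 (fun u => u) x y 1 (derivable_pt_lim_id x)). Qed.

Lemma differentiable_pt_lim_snd (x y : R) :
  differentiable_pt_lim (fun _ v => v) x y 0 1.
Proof.
intros eps; exists eps; intros u v Hu Hv.
replace (v - y - (0 * (u - x) + 1 * (v - y))) with 0 by ring.
rewrite Rabs_R0. apply Rmult_le_pos; [apply Rlt_le, cond_pos |].
apply Rle_trans with (Rabs (u - x)); [apply Rabs_pos | apply Rmax_l].
Qed.

Lemma differentiable_pt_lim_plus (f g : R -> R -> R) (x y a b c d : R) :
  differentiable_pt_lim f x y a b -> differentiable_pt_lim g x y c d ->
  differentiable_pt_lim (fun u v => f u v + g u v) x y (a + c) (b + d).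
Proof.
intros Hf Hg eps.
assert (H2 : 0 < eps / 2) by (assert (H := cond_pos eps); lra).
destruct (Hf (mkposreal _ H2)) as [d1 H1].
destruct (Hg (mkposreal _ H2)) as [d2 Hd2].
exists (mkposreal _ (Rmin_pos _ _ (cond_pos d1) (cond_pos d2))); simpl; intros u v Hu Hv.
assert (m1 := Rmin_l d1 d2); assert (m2 := Rmin_r d1 d2).
specialize (H1 u v ltac:(lra) ltac:(lra)); simpl in H1.
specialize (Hd2 u v ltac:(lra) ltac:(lra)); simpl in Hd2.
eapply Rle_trans; [| eapply Rle_trans; [exact (Rplus_le_compat _ _ _ _ H1 Hd2) | right; field]].
eapply Rle_trans; [| apply Rabs_triang]. right; f_equal; ring.
Qed.

Lemma differentiable_pt_lim_mult (f g : R -> R -> R) (x y a b c d : R) :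
  differentiable_pt_lim f x y a b -> differentiable_pt_lim g x y c d ->
  differentiable_pt_lim (fun u v => f u v * g u v) x y
    (g x y * a + f x y * c) (g x y * b + f x y * d).
Proof.
intros Hf Hg.
apply (differentiable_pt_lim_comp (fun u v => u * v) f g x y (g x y) (f x y) a b c d);
  [| exact Hf | exact Hg].
set (p := f x y); set (q := g x y).
intros eps; exists eps; intros u v Hu Hv.
(* The remainder of the product at first order is exactly the product of the two increments, so
   [del = eps] suffices. *)
replace (u * v - p * q - (q * (u - p) + p * (v - q))) with ((u - p) * (v - q)) by ring.
rewrite Rabs_mult.
apply Rle_trans with (eps * Rabs (v - q)).
- apply Rmult_le_compat_r; [apply Rabs_pos | lra].
- apply Rmult_le_compat_l; [apply Rlt_le, cond_pos | apply Rmax_r].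
Qed.

Lemma cderiv_Cexp (z : Cx) : cderiv_at Cexp z (Cexp z).
Proof.
assert (E := differentiable_pt_lim_comp1 exp _ _ _ _ _ _
  (derivable_pt_lim_exp (fst z)) (differentiable_pt_lim_fst (fst z) (snd z))).
assert (Cs := differentiable_pt_lim_comp1 cos _ _ _ _ _ _
  (derivable_pt_lim_cos (snd z)) (differentiable_pt_lim_snd (fst z) (snd z))).
assert (S := differentiable_pt_lim_comp1 sin _ _ _ _ _ _
  (derivable_pt_lim_sin (snd z)) (differentiable_pt_lim_snd (fst z) (snd z))).
assert (H1 := differentiable_pt_lim_mult _ _ _ _ _ _ _ _ E Cs).
assert (H2 := differentiable_pt_lim_mult _ _ _ _ _ _ _ _ E S).
unfold Cexp at 2; apply cderiv_of_partials; simpl.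
- replace (exp (fst z) * cos (snd z)) with
    (cos (snd z) * (exp (fst z) * 1) + exp (fst z) * (- sin (snd z) * 0)) by ring.
  replace (- (exp (fst z) * sin (snd z))) with
    (cos (snd z) * (exp (fst z) * 0) + exp (fst z) * (- sin (snd z) * 1)) by ring.
  exact H1.
- replace (exp (fst z) * sin (snd z)) with
    (sin (snd z) * (exp (fst z) * 1) + exp (fst z) * (cos (snd z) * 0)) by ring.
  replace (exp (fst z) * cos (snd z)) with
    (sin (snd z) * (exp (fst z) * 0) + exp (fst z) * (cos (snd z) * 1)) by ring.
  exact H2.
Qed.

(** The principal logarithm on the right half-plane, where the argument is the arctangent of the
    slope. This domain suffices, since [1 + zeta] and [1 - zeta] have positive real part for [zeta]
    in the disk. *)
Definition Clog (z : Cx) : Cx := (/ 2 * ln (fst z * fst z + snd z * snd z), atan (snd z * / fst z)).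

Lemma cderiv_Clog (z : Cx) : 0 < fst z -> exists l, cderiv_at Clog z l.
Proof.
destruct z as [x y]; simpl; intros Hx.
assert (X := differentiable_pt_lim_fst x y).
assert (Y := differentiable_pt_lim_snd x y).
assert (Hq : 0 < x * x + y * y) by nra.
assert (HX := differentiable_pt_lim_mult _ _ _ _ _ _ _ _ X X).
assert (HY := differentiable_pt_lim_mult _ _ _ _ _ _ _ _ Y Y).
assert (N := differentiable_pt_lim_plus _ _ _ _ _ _ _ _ HX HY).
assert (DL : derivable_pt_lim (fun t => / 2 * ln t) (x * x + y * y) (/ 2 * / (x * x + y * y))).
{ apply derivable_pt_lim_scal, derivable_pt_lim_ln, Hq. }
assert (L := differentiable_pt_lim_comp1 _ _ _ _ _ _ _ DL N).
assert (DI : derivable_pt_lim Rinv x (- / (x * x))).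
{ apply is_derive_Reals; auto_derive; [lra | field; lra]. }
assert (I := differentiable_pt_lim_comp1 _ _ _ _ _ _ _ DI X).
assert (Q := differentiable_pt_lim_mult _ _ _ _ _ _ _ _ Y I).
assert (DA := derivable_pt_lim_atan (y * / x)).
assert (A := differentiable_pt_lim_comp1 _ _ _ _ _ _ _ DA Q).
clear - Hx Hq L A.
exists (x / (x * x + y * y), - (y / (x * x + y * y))).
assert (x * x + y * y <> 0) by lra.
assert (0 < 1 + (y * / x) ^ 2) by nra.
assert (E : 1 + (y * / x) ^ 2 = (x * x + y * y) / (x * x)) by (field; lra).
rewrite E in A.
apply cderiv_of_partials; simpl.
- match type of L with differentiable_pt_lim _ _ _ ?a ?b =>
    replace (x / (x * x + y * y)) with a by (field; lra);
    replace (- - (y / (x * x + y * y))) with b by (field; lra) end.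
  exact L.
- match type of A with differentiable_pt_lim _ _ _ ?a ?b =>
    replace (- (y / (x * x + y * y))) with a by (field; repeat split; nra);
    replace (x / (x * x + y * y)) with b by (field; repeat split; nra) end.
  exact A.
Qed.

(** * The test functions *)

Lemma exp_le (x y : R) : x <= y -> exp x <= exp y.
Proof.
intros [H | ->]; [left; apply exp_increasing, H | apply Rle_refl].
Qed.

(* Telescoping: [exp (- a^2) <= 1 / (1 + a^2) <= 3 (atan (a + 1) - atan a)]. *)
Lemma gaussian_sum_bound (y : R) (N : nat) :
  sum_f_R0 (fun n => exp (- (y - INR n) ^ 2)) N <= 3 * PI.
Proof.
assert (step : forall a, exp (- a ^ 2) <= 3 * (atan (a + 1) - atan a)).
{ intros a.
  destruct (MVT_cor2 atan (fun x => / (1 + x ^ 2)) a (a + 1)) as [c [E Hc]];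
    [lra | intros; apply derivable_pt_lim_atan |].
  rewrite E.
  (* From [c = a + (c - a)] with [0 < c - a < 1]; hence [1 + c^2 <= 3 (1 + a^2)], which is the
     origin of the factor 3. *)
  assert (c ^ 2 <= 2 * a ^ 2 + 2)
    by (assert (H := pow2_ge_0 (a - (c - a))); nra).
  apply Rle_trans with (/ (1 + a ^ 2)).
  - rewrite exp_Ropp. apply Rinv_le_contravar; [nra | apply exp_ineq1_le].
  - replace (3 * (/ (1 + c ^ 2) * (a + 1 - a))) with (/ ((1 + c ^ 2) / 3))
      by (field; nra).
    apply Rinv_le_contravar; nra. }
assert (tel : sum_f_R0 (fun n => exp (- (y - INR n) ^ 2)) N
              <= 3 * (atan (INR N + 1 - y) - atan (- y))).
{ induction N as [|N IH].
  - change (exp (- (y - 0) ^ 2) <= 3 * (atan (0 + 1 - y) - atan (- y))).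
    replace (- (y - 0) ^ 2) with (- (- y) ^ 2) by ring.
    replace (0 + 1 - y) with (- y + 1) by ring. apply step.
  - rewrite tech5. assert (S := step (INR N + 1 - y)).
    rewrite S_INR.
    replace (- (y - (INR N + 1)) ^ 2) with (- (INR N + 1 - y) ^ 2) by ring.
    replace (INR N + 1 + 1 - y) with (INR N + 1 - y + 1) by ring. lra. }
assert (A1 := atan_bound (INR N + 1 - y)). assert (A2 := atan_bound (- y)). lra.
Qed.

(** Isolates the dominant term [m]: the other terms cost at most [eps * b n] each, and subtracting
    this cost for [n = m] too only weakens the bound. *)
Lemma sum_ge_one_term (a b : nat -> R) (m N : nat) (eps c : R) :
  (m <= N)%nat -> (forall n, 0 <= b n) -> 0 <= eps ->
  (forall n, - eps * b n <= a n) -> c <= a m ->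
  c - eps * sum_f_R0 b N <= sum_f_R0 a N.
Proof.
intros Hm Hb He Ha Hc.
assert (G : forall n, - eps * sum_f_R0 b n <= sum_f_R0 a n).
{ induction n as [|n IH]; simpl; [apply Ha |]. specialize (Ha (S n)); lra. }
induction Hm as [|N Hm IH].
- destruct m as [|m]; simpl.
  + assert (P := Rmult_le_pos _ _ He (Hb 0%nat)); lra.
  + assert (P := Rmult_le_pos _ _ He (Hb (S m))). specialize (G m). lra.
- simpl. specialize (Ha (S N)). lra.
Qed.

(* In a Gaussian sum with cosine weights, the nearest node contributes at least
   [exp (-8/4) / 2], and a node at distance [a >= 1] at least [- exp (-7) exp (- a^2)]. *)
Definition test_const : R := exp (-2) / 2 - exp (-7) * (3 * PI).

Lemma test_const_pos : 0 < test_const.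
Proof.
unfold test_const.
assert (P := PI_4).
assert (E2 : 2 <= exp 1) by (assert (H := exp_ineq1_le 1); lra).
(* After factoring out [exp (-7)], the claim is [e^5 / 2 > 3 * PI]; it follows from [e >= 2], so
   [e^5 >= 32], and [PI <= 4]. *)
replace (-2) with (-7 + (1 + 1 + 1 + 1 + 1)) by ring.
rewrite !exp_plus.
assert (E7 : 0 < exp (-7)) by apply exp_pos.
assert (E5 : 32 <= exp 1 * exp 1 * exp 1 * exp 1 * exp 1).
{ assert (4 <= exp 1 * exp 1) by nra.
  assert (16 <= (exp 1 * exp 1) * (exp 1 * exp 1)) by nra. nra. }
revert E5; generalize (exp 1 * exp 1 * exp 1 * exp 1 * exp 1); intros x E5.
nra.
Qed.

(** The phase [s] differs from the node phase [v n] by at most the distance from [y] to [n].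
    Negative cosines can therefore occur only at distance more than 1, where the Gaussian is already
    small. *)
Lemma gaussian_cos_sum_ge (y s : R) (v : nat -> R) (N : nat) :
  0 <= y -> y + 1 <= INR N ->
  (forall n, Rabs (s - v n) <= Rabs (y - INR n)) ->
  test_const <= sum_f_R0 (fun n => exp (- 8 * (y - INR n) ^ 2) * cos (s - v n)) N.
Proof.
intros Hy HN Hv.
assert (P := PI2_3_2).
assert (C1 : forall x, Rabs x <= 1 -> 1 / 2 <= cos x).
{ intros x Hx. rewrite <- cos_PI3.
  assert (H3 : PI / 3 >= 1) by (unfold PI2 in P; lra).
  destruct (Rle_dec 0 x).
  - rewrite Rabs_pos_eq in Hx by assumption. apply cos_decr_1; lra.
  - rewrite Rabs_left in Hx by lra. rewrite <- (cos_neg x). apply cos_decr_1; lra. }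
(* [m] is the integer nearest to [y]; the margin in [y + 1 <= INR N] ensures that it is one of the
   summation indices. *)
destruct (nfloor_ex (y + / 2)) as [m [Hm1 Hm2]]; [lra |].
assert (HmN : (m <= N)%nat).
{ apply INR_le. lra. }
assert (Hn : Rabs (y - INR m) <= / 2) by (apply Rabs_le; lra).
assert (B := gaussian_sum_bound y N).
apply Rle_trans with (exp (-2) / 2 - exp (-7) * sum_f_R0 (fun n => exp (- (y - INR n) ^ 2)) N).
{ unfold test_const. assert (0 < exp (-7)) by apply exp_pos. nra. }
apply (sum_ge_one_term _ _ m); try assumption.
- intros n; apply Rlt_le, exp_pos.
- apply Rlt_le, exp_pos.
- intros n. assert (H0 := exp_pos (- 8 * (y - INR n) ^ 2)).
  assert (H7 : 0 < exp (-7) * exp (- (y - INR n) ^ 2))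
    by (apply Rmult_lt_0_compat; apply exp_pos).
  destruct (Rle_dec (Rabs (y - INR n)) 1) as [H1|H1].
  + specialize (C1 (s - v n) (Rle_trans _ _ _ (Hv n) H1)). nra.
  + assert (Hc := COS_bound (s - v n)).
    (* With [a = y - INR n] and [a^2 >= 1], one has [8 a^2 >= 7 + a^2]: this extracts the factor
       [exp (-7)] and leaves a summable Gaussian. *)
    assert (H2 : 1 <= (y - INR n) ^ 2) by (rewrite <- pow2_abs; nra).
    assert (H3 : exp (- 8 * (y - INR n) ^ 2) <= exp (-7) * exp (- (y - INR n) ^ 2)).
    { rewrite <- exp_plus. apply exp_le. lra. }
    nra.
- specialize (C1 (s - v m) ltac:(specialize (Hv m); lra)).
  assert (H3 : exp (-2) <= exp (- 8 * (y - INR m) ^ 2)).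
  { apply exp_le. rewrite <- pow2_abs.
    assert (0 <= Rabs (y - INR m)) by apply Rabs_pos. nra. }
  assert (0 < exp (-2)) by apply exp_pos. nra.
Qed.

(** * Finite complex sums, moduli and rotations, and the construction of the test function *)

Definition Csum (F : nat -> Cx -> Cx) (N : nat) (z : Cx) : Cx :=
  (sum_f_R0 (fun n => fst (F n z)) N, sum_f_R0 (fun n => snd (F n z)) N).

Lemma cderiv_Csum (F : nat -> Cx -> Cx) (N : nat) :
  (forall n z, inD z -> exists l, cderiv_at (F n) z l) ->
  forall z, inD z -> exists l, cderiv_at (Csum F N) z l.
Proof.
intros HF z Hz. induction N as [|N [l IH]].
- destruct (HF 0%nat z Hz) as [l Hl]; exists l. exact Hl.
- destruct (HF (S N) z Hz) as [m Hm]; exists (Cadd l m).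
  exact (cderiv_add _ _ _ _ _ IH Hm).
Qed.

Lemma Cmod_Csum_le (F : nat -> Cx -> Cx) (N : nat) (z : Cx) :
  Cmod (Csum F N z) <= sum_f_R0 (fun n => Cmod (F n z)) N.
Proof.
induction N as [|N IH]; [apply Rle_refl |].
rewrite tech5. eapply Rle_trans; [exact (Cmod_triangle (Csum F N z) (F (S N) z)) |].
apply Rplus_le_compat_r, IH.
Qed.

Lemma Cmod_nonneg (z : Cx) : 0 <= Cmod z.
Proof. exact (Cmod_ge_0 z). Qed.

Lemma Cmod_Cmul (z w : Cx) : Cmod (Cmul z w) = Cmod z * Cmod w.
Proof. exact (Cmod_mult z w). Qed.

Lemma fst_le_Cmod (z : Cx) : Rabs (fst z) <= Cmod z.
Proof. exact (re_le_Cmod z). Qed.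

Lemma Cmod_Cexp (p : Cx) : Cmod (Cexp p) = exp (fst p).
Proof.
unfold Cmod, Cexp; simpl fst; simpl snd.
replace ((exp (fst p) * cos (snd p)) ^ 2 + (exp (fst p) * sin (snd p)) ^ 2)
  with (Rsqr (exp (fst p)) * (Rsqr (sin (snd p)) + Rsqr (cos (snd p))))
  by (unfold Rsqr; ring).
rewrite sin2_cos2, Rmult_1_r. apply sqrt_Rsqr, Rlt_le, exp_pos.
Qed.

Lemma Cmod_polar (r theta : R) : 0 <= r -> Cmod (polar r theta) = r.
Proof.
intros Hr. unfold Cmod, polar; simpl fst; simpl snd.
replace ((r * cos theta) ^ 2 + (r * sin theta) ^ 2)
  with (Rsqr r * (Rsqr (sin theta) + Rsqr (cos theta))) by (unfold Rsqr; ring).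
rewrite sin2_cos2, Rmult_1_r. apply sqrt_Rsqr, Hr.
Qed.

Lemma Cmod_sqr (z : Cx) : Cmod z ^ 2 = fst z ^ 2 + snd z ^ 2.
Proof.
unfold Cmod. apply pow2_sqrt.
assert (A := pow2_ge_0 (fst z)); assert (B := pow2_ge_0 (snd z)); lra.
Qed.

Definition rot (theta : R) (z : Cx) : Cx := Cmul z (cos theta, - sin theta).

Lemma Cmod_rot (theta : R) (z : Cx) : Cmod (rot theta z) = Cmod z.
Proof.
unfold rot. rewrite Cmod_Cmul.
replace (cos theta, - sin theta) with (polar 1 (- theta))
  by (unfold polar; rewrite cos_neg, sin_neg; f_equal; ring).
rewrite Cmod_polar by lra. ring.
Qed.

Lemma rot_polar (r theta : R) : rot theta (polar r theta) = (r, 0).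
Proof.
unfold rot, polar, Cmul; simpl. f_equal; [| ring].
replace (r * cos theta * cos theta - r * sin theta * - sin theta)
  with (r * (Rsqr (sin theta) + Rsqr (cos theta))) by (unfold Rsqr; ring).
rewrite sin2_cos2; ring.
Qed.

(** With [zeta = rot theta z] and [W = l2 - l1], this is [-alpha log(1 - zeta) - i v_n - 8 (L W -
    n)^2]. Collecting everything in one exponent makes the modulus of the term the exponential of a
    real part. *)
Definition test_exponent (alpha L theta : R) (v : nat -> R) (n : nat) (z : Cx) : Cx :=
  let l1 := Clog (Csub (1, 0) (rot theta z)) in
  let l2 := Clog (Cadd (1, 0) (rot theta z)) in
  let q := Csub (Cmul (L, 0) (Csub l2 l1)) (INR n, 0) in
  Csub (Csub (Cmul (- alpha, 0) l1) (0, v n)) (Cmul (8, 0) (Cmul q q)).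

Definition test_term (alpha L theta : R) (v : nat -> R) (n : nat) (z : Cx) : Cx :=
  Cexp (test_exponent alpha L theta v n z).

Lemma rot_inD (theta : R) (z : Cx) : inD z -> -1 < fst (rot theta z) < 1.
Proof.
unfold inD; rewrite <- (Cmod_rot theta z); intros Hz.
assert (H : Rabs (fst (rot theta z)) <= Cmod (rot theta z)) by apply fst_le_Cmod.
assert (H1 : Rabs (fst (rot theta z)) < 1) by lra.
apply Rabs_lt_between in H1. lra.
Qed.

Lemma cderiv_test_term (alpha L theta : R) (v : nat -> R) (n : nat) (z : Cx) :
  inD z -> exists l, cderiv_at (test_term alpha L theta v n) z l.
Proof.
intros Hz. assert (H := rot_inD theta z Hz).
assert (Hr := cderiv_mul _ _ _ _ _ (cderiv_id z) (cderiv_const (cos theta, - sin theta) z)).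
change (fun w => Cmul w (cos theta, - sin theta)) with (rot theta) in Hr.
assert (H1 := cderiv_sub _ _ _ _ _ (cderiv_const (1, 0) z) Hr).
assert (H2 := cderiv_add _ _ _ _ _ (cderiv_const (1, 0) z) Hr).
destruct (cderiv_Clog (Csub (1, 0) (rot theta z)) ltac:(simpl in *; lra)) as [l1 L1].
destruct (cderiv_Clog (Cadd (1, 0) (rot theta z)) ltac:(simpl in *; lra)) as [l2 L2].
assert (D1 := cderiv_comp Clog (fun w => Csub (1, 0) (rot theta w)) _ _ _ L1 H1).
assert (D2 := cderiv_comp Clog (fun w => Cadd (1, 0) (rot theta w)) _ _ _ L2 H2).
assert (Q := cderiv_sub _ _ _ _ _
  (cderiv_mul _ _ _ _ _ (cderiv_const (L, 0) z) (cderiv_sub _ _ _ _ _ D2 D1))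
  (cderiv_const (INR n, 0) z)).
assert (E := cderiv_sub _ _ _ _ _
  (cderiv_sub _ _ _ _ _ (cderiv_mul _ _ _ _ _ (cderiv_const (- alpha, 0) z) D1)
    (cderiv_const (0, v n) z))
  (cderiv_mul _ _ _ _ _ (cderiv_const (8, 0) z) (cderiv_mul _ _ _ _ _ Q Q))).
eexists. exact (cderiv_comp Cexp (test_exponent alpha L theta v n) _ _ _ (cderiv_Cexp _) E).
Qed.

(** The real part of [-8 (L W - n)^2] is [-8 (L Re W - n)^2 + 8 (L Im W)^2], and [Im W], a
    difference of two angles in [(-PI/2, PI/2)], is bounded by [PI]. The centre [y = L Re W] is the
    same for all [n], so these bounds can be summed. *)
Lemma test_term_bound (alpha L theta : R) (v : nat -> R) (z : Cx) :
  0 <= alpha -> inD z -> exists y, forall n,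
  wgt alpha z * Cmod (test_term alpha L theta v n z)
    <= exp (alpha * ln 2 + 8 * (L * PI) ^ 2) * exp (- (y - INR n) ^ 2).
Proof.
intros Ha Hz. assert (Hr := rot_inD theta z Hz).
set (l1 := Clog (Csub (1, 0) (rot theta z))).
set (l2 := Clog (Cadd (1, 0) (rot theta z))).
exists (L * (fst l2 - fst l1)). intros n.
unfold test_term; rewrite Cmod_Cexp. unfold wgt, Rpower; rewrite <- !exp_plus.
apply exp_le.
assert (E : fst (test_exponent alpha L theta v n z) =
  - alpha * fst l1 - 8 * (L * (fst l2 - fst l1) - INR n) ^ 2
  + 8 * (L * (snd l2 - snd l1)) ^ 2).
{ unfold test_exponent; fold l1 l2; unfold Csub, Cmul; simpl; ring. }
rewrite E.
assert (B : (L * (snd l2 - snd l1)) ^ 2 <= (L * PI) ^ 2).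
{ assert (A1 := atan_bound (snd (Csub (1, 0) (rot theta z)) * / fst (Csub (1, 0) (rot theta z)))).
  assert (A2 := atan_bound (snd (Cadd (1, 0) (rot theta z)) * / fst (Cadd (1, 0) (rot theta z)))).
  change (- PI / 2 < snd l1 < PI / 2) in A1. change (- PI / 2 < snd l2 < PI / 2) in A2.
  rewrite !Rpow_mult_distr. apply Rmult_le_compat_l; [apply pow2_ge_0 |].
  nra. }
(* This is [1 - |z|^2 <= 2 (1 - |z|) <= 2 |1 - zeta|], compared in squared form because [fst l1] is
   half the logarithm of a squared modulus. *)
assert (W : ln (1 - Cmod z ^ 2) - fst l1 <= ln 2).
{ assert (M0 : 0 <= Cmod z) by apply Cmod_nonneg.
  assert (M1 : fst (rot theta z) <= Cmod z).
  { rewrite <- (Cmod_rot theta z).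
    apply Rle_trans with (Rabs (fst (rot theta z))); [apply Rle_abs | apply fst_le_Cmod]. }
  unfold inD in Hz. set (m := Cmod z) in *.
  assert (Hm : 0 < 1 - m ^ 2) by nra.
  set (a := fst (rot theta z)) in *; set (b := snd (rot theta z)).
  set (s := (1 - a) * (1 - a) + (0 - b) * (0 - b)).
  assert (Hs : (1 - m) * (1 - m) <= s).
  { assert (0 <= b * b) by apply Rle_0_sqr. unfold s; nra. }
  assert (Hs0 : 0 < s) by nra.
  assert (K : ln ((1 - m ^ 2) * (1 - m ^ 2)) <= ln (2 * 2 * s)).
  { apply ln_le; [nra |].
    replace ((1 - m ^ 2) * (1 - m ^ 2)) with ((1 + m) * (1 + m) * ((1 - m) * (1 - m))) by ring.
    apply Rmult_le_compat; [nra | nra | apply Rmult_le_compat; lra | exact Hs]. }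
  rewrite (ln_mult _ _ Hm Hm), (ln_mult (2 * 2)), (ln_mult 2) in K by lra.
  change (fst l1) with (/ 2 * ln s). lra. }
assert (0 <= (L * (fst l2 - fst l1) - INR n) ^ 2) by apply pow2_ge_0.
nra.
Qed.

(* The hyperbolic distance from 0 to r, normalized so that [hyp' = 2 / (1 - r^2)]. *)
Definition hyp (r : R) : R := ln (1 + r) - ln (1 - r).

(** On the radius of angle [theta] both logarithms are real, so the Gaussian is real and the only
    phase in the term is [exp(-i v_n)]. *)
Lemma test_term_radial (alpha L theta : R) (v : nat -> R) (n : nat) (r s : R) :
  0 <= r < 1 ->
  fst (Cmul (test_term alpha L theta v n (polar r theta)) (cos s, sin s)) =
  exp (- alpha * ln (1 - r)) * (exp (- 8 * (L * hyp r - INR n) ^ 2) * cos (s - v n)).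
Proof.
intros Hr.
assert (C : forall a, 0 < a -> Clog (a, 0) = (ln a, 0)).
{ intros a Pa. unfold Clog; simpl. rewrite !Rmult_0_l, atan_0, Rplus_0_r, ln_mult by lra.
  f_equal; lra. }
unfold test_term, test_exponent. rewrite rot_polar.
replace (Csub (1, 0) (r, 0)) with (1 - r, 0) by (unfold Csub; simpl; f_equal; ring).
replace (Cadd (1, 0) (r, 0)) with (1 + r, 0) by (unfold Cadd; simpl; f_equal; ring).
rewrite !C by lra. unfold hyp, Cexp, Csub, Cmul; simpl fst; simpl snd.
rewrite <- (Rmult_assoc (exp _) (exp _)), <- exp_plus.
match goal with |- exp ?A * cos ?B * _ - _ = exp ?A' * _ =>
  replace A with A' by ring; replace B with (- v n) by ring end.
rewrite cos_minus, cos_neg, sin_neg. ring.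
Qed.

Lemma hyp_incr (r t : R) : 0 <= r <= t -> t < 1 -> 0 <= hyp r <= hyp t.
Proof.
intros Hr Ht. unfold hyp.
assert (ln (1 + r) <= ln (1 + t)) by (apply ln_le; lra).
assert (ln (1 - t) <= ln (1 - r)) by (apply ln_le; lra).
assert (ln (1 - r) <= ln (1 + r)) by (apply ln_le; lra). lra.
Qed.

Lemma hyp_surj (x : R) : 0 <= x -> exists r, 0 <= r < 1 /\ hyp r = x.
Proof.
intros Hx.
assert (E1 : 1 <= exp x) by (rewrite <- exp_0; apply exp_le, Hx).
(* The witness is [tanh (x / 2)]. *)
exists ((exp x - 1) / (exp x + 1)); split.
- split.
  + apply Rmult_le_pos; [lra | apply Rlt_le, Rinv_0_lt_compat; lra].
  + apply Rlt_div_l; lra.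
- unfold hyp.
  replace (1 + (exp x - 1) / (exp x + 1)) with (exp x * (2 / (exp x + 1))) by (field; lra).
  replace (1 - (exp x - 1) / (exp x + 1)) with (2 / (exp x + 1)) by (field; lra).
  rewrite ln_mult, ln_exp; [ring | lra | apply Rdiv_lt_0_compat; lra].
Qed.

(** The Lipschitz constant [L] also fixes the mesh: nodes lie at hyperbolic coordinate [n / L], so
    [psi] moves by at most 1 between neighbours. The upper bound depends on neither [theta] nor [t],
    although the number of nodes grows with [t]. *)
Lemma test_function (alpha L theta t : R) (psi : R -> R) :
  0 <= alpha -> 0 < L -> 0 <= t < 1 ->
  (forall r r', 0 <= r < 1 -> 0 <= r' < 1 ->
     Rabs (psi r - psi r') <= L * Rabs (hyp r - hyp r')) ->
  exists f, holoD f /\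
    (forall z, inD z ->
       wgt alpha z * Cmod (f z) <= exp (alpha * ln 2 + 8 * (L * PI) ^ 2) * (3 * PI)) /\
    (forall r, 0 <= r <= t ->
       test_const / Rpower (1 - r ^ 2) alpha
         <= fst (Cmul (f (polar r theta)) (cos (psi r), sin (psi r)))).
Proof.
intros Ha HL Ht Hpsi.
assert (Hx : forall n, exists r, 0 <= r < 1 /\ hyp r = INR n / L).
{ intros n. apply hyp_surj. apply Rmult_le_pos; [apply pos_INR |
     apply Rlt_le, Rinv_0_lt_compat, HL]. }
destruct (functional_choice _ Hx) as [rn Hrn].
set (v := fun n => psi (rn n)).
(* The successor of this floor exceeds [L * hyp t + 1], so the nodes reach past every radius up to
   [t] with the margin needed for the cosine sum. *)
destruct (nfloor_ex (L * hyp t + 1)) as [N0 [_ HN]].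
{ assert (H := hyp_incr 0 t ltac:(lra) ltac:(lra)). nra. }
set (N := S N0).
set (F := test_term alpha L theta v).
(* [holoD] asks for the derivative as a function, so pointwise derivatives are selected by choice;
   outside the disk the value is an arbitrary [C0]. *)
destruct (functional_choice (fun z l : Cx => inD z -> cderiv_at (Csum F N) z l)) as [df Hdf].
{ intros z. destruct (Rlt_dec (Cmod z) 1) as [Hz|Hz].
  - destruct (cderiv_Csum F N (fun n w Hw => cderiv_test_term alpha L theta v n w Hw) z Hz)
      as [l Hl]; exists l; auto.
  - exists C0; intros; contradiction. }
exists (Csum F N); split; [exists df; exact Hdf | split].
- intros z Hz.
  destruct (test_term_bound alpha L theta v z Ha Hz) as [y Hy].
  apply Rle_trans with (exp (alpha * ln 2 + 8 * (L * PI) ^ 2)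
    * sum_f_R0 (fun n => exp (- (y - INR n) ^ 2)) N).
  + eapply Rle_trans.
    { apply Rmult_le_compat_l; [apply Rlt_le, exp_pos | apply Cmod_Csum_le]. }
    rewrite !scal_sum. apply sum_Rle; intros n _.
    rewrite (Rmult_comm _ (wgt alpha z)), (Rmult_comm _ (exp (_ + _))). apply Hy.
  + apply Rmult_le_compat_l; [apply Rlt_le, exp_pos | apply gaussian_sum_bound].
- intros r Hr.
  assert (E : fst (Cmul (Csum F N (polar r theta)) (cos (psi r), sin (psi r))) =
    exp (- alpha * ln (1 - r)) *
    sum_f_R0 (fun n => exp (- 8 * (L * hyp r - INR n) ^ 2) * cos (psi r - v n)) N).
  { assert (Hr1 : 0 <= r < 1) by lra. clear - Hr1. induction N as [|k IH].
    - apply (test_term_radial alpha L theta v 0 r (psi r)); exact Hr1.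
    - rewrite tech5, Rmult_plus_distr_l, <- IH.
      rewrite <- (test_term_radial alpha L theta v (S k) r (psi r)) by lra.
      unfold Csum, Cmul; simpl. fold F. ring. }
  rewrite E.
  assert (Hh := hyp_incr r t Hr ltac:(lra)).
  assert (G : test_const <=
    sum_f_R0 (fun n => exp (- 8 * (L * hyp r - INR n) ^ 2) * cos (psi r - v n)) N).
  { apply gaussian_cos_sum_ge.
    - nra.
    - unfold N; rewrite S_INR. nra.
    - intros n. destruct (Hrn n) as [H1 H2].
      eapply Rle_trans; [apply Hpsi; [lra | exact H1] |].
      rewrite H2. rewrite <- (Rabs_pos_eq L) at 1 by lra. rewrite <- Rabs_mult.
      right; f_equal. field; lra. }
  assert (P := test_const_pos).
  unfold Rdiv. rewrite (Rmult_comm test_const), <- Rpower_Ropp. unfold Rpower.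
  apply Rmult_le_compat; [apply Rlt_le, exp_pos | lra | | exact G].
  apply exp_le.
  (* Since [1 - r <= 1 - r^2] and [alpha >= 0], the factor [(1 - r)^(-alpha)] dominates
     [(1 - r^2)^(-alpha)]. *)
  assert (ln (1 - r) <= ln (1 - r ^ 2)) by (apply ln_le; nra).
  nra.
Qed.

(** * Integrals along radii *)

Lemma integral_eq_is_RInt (f : R -> R) (a b I : R) :
  integral_eq f a b I <-> is_RInt f a b I.
Proof.
split.
- intros [pr E]. rewrite <- E, <- (RInt_Reals f a b pr).
  apply (RInt_correct (V := R_CompleteNormedModule)), ex_RInt_Reals_1, pr.
- intros H. assert (E : ex_RInt f a b) by (exists I; exact H).
  exists (ex_RInt_Reals_0 f a b E). rewrite <- RInt_Reals. apply is_RInt_unique, H.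
Qed.

Lemma is_RInt_nonneg (f : R -> R) (a b I : R) :
  a <= b -> is_RInt f a b I -> (forall x, a < x < b -> 0 <= f x) -> 0 <= I.
Proof.
intros Hab HI Hf.
assert (Z := is_RInt_const (V := R_NormedModule) a b 0).
assert (E : scal (b - a) (0 : R_NormedModule) = 0) by apply Rmult_0_r.
rewrite E in Z.
exact (is_RInt_le _ _ a b 0 I Hab Z HI Hf).
Qed.

Lemma polar_inD (r theta : R) : 0 <= r < 1 -> inD (polar r theta).
Proof. intros Hr. unfold inD. rewrite Cmod_polar; lra. Qed.

Lemma Cmod_Cmul_polar (z : Cx) (theta : R) : Cmod (Cmul z (polar 1 theta)) = Cmod z.
Proof. rewrite Cmod_Cmul, Cmod_polar; lra. Qed.

Lemma snd_le_Cmod (z : Cx) : Rabs (snd z) <= Cmod z.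
Proof. eapply Rle_trans; [apply Rmax_r | exact (Rmax_Cmod z)]. Qed.

Lemma is_derive_polar (f : Cx -> Cx) (r theta : R) (l : Cx) :
  cderiv_at f (polar r theta) l ->
  is_derive (fun s => fst (f (polar s theta))) r (fst (Cmul l (polar 1 theta))) /\
  is_derive (fun s => snd (f (polar s theta))) r (snd (Cmul l (polar 1 theta))).
Proof.
intros H.
assert (G : forall eps, 0 < eps -> exists d : posreal, forall k, k <> 0 -> Rabs k < d ->
  Cmod (Csub (Csub (f (polar (r + k) theta)) (f (polar r theta)))
             (Cmul l (polar k theta))) < eps * Rabs k).
{ intros eps He. destruct (H (eps / 2)) as [d [Hd Hd']]; [lra |].
  exists (mkposreal d Hd); intros k Hk0 Hk; simpl in Hk.
  assert (E : Csub (polar (r + k) theta) (polar r theta) = polar k theta)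
    by (unfold Csub, polar; simpl; f_equal; ring).
  assert (Ek : Cmod (polar k theta) = Rabs k).
  { unfold Cmod, polar; simpl fst; simpl snd.
    replace ((k * cos theta) ^ 2 + (k * sin theta) ^ 2)
      with (Rsqr k * (Rsqr (sin theta) + Rsqr (cos theta))) by (unfold Rsqr; ring).
    rewrite sin2_cos2, Rmult_1_r. apply sqrt_Rsqr_abs. }
  assert (Pk := Rabs_pos_lt k Hk0).
  specialize (Hd' (polar (r + k) theta)). rewrite E, Ek in Hd'.
  specialize (Hd' ltac:(lra)). nra. }
(* [p] stands for the real or the imaginary part, so both derivatives come from one argument. *)
assert (K : forall (p : Cx -> R), (forall z, Rabs (p z) <= Cmod z) ->
  (forall z w, p (Csub z w) = p z - p w) ->
  (forall c z, p (Cmul l (polar c z)) = c * p (Cmul l (polar 1 z))) ->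
  is_derive (fun s => p (f (polar s theta))) r (p (Cmul l (polar 1 theta)))).
{ intros p Hp Hsub Hl. apply is_derive_Reals. intros eps He.
  destruct (G eps He) as [d Hd]; exists d. intros k Hk0 Hk.
  specialize (Hd k Hk0 Hk).
  specialize (Hp (Csub (Csub (f (polar (r + k) theta)) (f (polar r theta)))
                       (Cmul l (polar k theta)))).
  rewrite !Hsub, (Hl k theta) in Hp.
  assert (Pk := Rabs_pos_lt k Hk0).
  replace ((p (f (polar (r + k) theta)) - p (f (polar r theta))) / k - p (Cmul l (polar 1 theta)))
    with ((p (f (polar (r + k) theta)) - p (f (polar r theta)) - k * p (Cmul l (polar 1 theta))) / k)
    by (field; exact Hk0).
  rewrite Rabs_div by exact Hk0. apply Rlt_div_l; lra. }
split; apply K.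
- exact fst_le_Cmod.
- reflexivity.
- intros c z. unfold Cmul, polar; simpl; ring.
- exact snd_le_Cmod.
- reflexivity.
- intros c z. unfold Cmul, polar; simpl; ring.
Qed.

Lemma continuous_polar (f : Cx -> Cx) (r theta : R) :
  holoD f -> 0 <= r < 1 ->
  continuous (fun s => fst (f (polar s theta))) r /\
  continuous (fun s => snd (f (polar s theta))) r.
Proof.
intros [df Hf] Hr.
destruct (is_derive_polar f r theta _ (Hf _ (polar_inD r theta Hr))) as [H1 H2].
split; apply (ex_derive_continuous (V := R_NormedModule)); eexists; eassumption.
Qed.

Lemma holoD_mul (f g : Cx -> Cx) :
  holoD f -> holoD g -> holoD (fun z => Cmul (f z) (g z)).
Proof.
intros [df Hf] [dg Hg].
exists (fun z => Cadd (Cmul (df z) (g z)) (Cmul (f z) (dg z))).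
intros z Hz; apply cderiv_mul; auto.
Qed.

Lemma holoD_exp (h : Cx -> Cx) : holoD h -> holoD (fun z => Cexp (h z)).
Proof.
intros [dh Hh]. exists (fun z => Cmul (dh z) (Cexp (h z))).
intros z Hz. apply (cderiv_comp Cexp h); [apply cderiv_Cexp | auto].
Qed.

Lemma polar_decomp (z : Cx) : exists theta, 0 <= theta < 2 * PI /\ z = polar (Cmod z) theta.
Proof.
assert (P := PI_RGT_0).
assert (M0 : 0 <= Cmod z) by exact (Cmod_nonneg z).
destruct (Req_dec (Cmod z) 0) as [E0 | N0].
{ exists 0; split; [lra |]. rewrite E0.
  assert (E : z = C0) by exact (Cmod_eq_0 z E0). rewrite E.
  unfold polar, C0; f_equal; ring. }
set (m := Cmod z) in *. assert (Hm : 0 < m) by lra.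
assert (S := Cmod_sqr z : m ^ 2 = _).
destruct z as [x y]; simpl fst in S; simpl snd in S.
set (c := x / m).
assert (Hxc : x = m * c) by (unfold c; field; lra).
assert (Hy : y ^ 2 = m ^ 2 * (1 - c ^ 2)) by (rewrite Hxc in S; lra).
assert (Hc : c ^ 2 <= 1).
{ assert (0 <= y ^ 2) by apply pow2_ge_0. assert (0 < m ^ 2) by nra.
  destruct (Rle_dec (c ^ 2) 1); [assumption | exfalso; nra]. }
assert (Hc1 : -1 <= c <= 1) by nra.
assert (Hys : Rabs y = m * sqrt (1 - Rsqr c)).
{ rewrite <- (sqrt_Rsqr m) at 1 by lra. rewrite <- sqrt_mult_alt by apply Rle_0_sqr.
  rewrite <- sqrt_Rsqr_abs. f_equal. unfold Rsqr in *. lra. }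
assert (B := acos_bound c).
destruct (Rle_dec 0 y) as [Y|Y].
- exists (acos c); split; [lra |].
  unfold polar. rewrite cos_acos, sin_acos by exact Hc1.
  rewrite <- Hys, Rabs_pos_eq by exact Y. f_equal; exact Hxc.
- exists (2 * PI - acos c); split.
  + split; [lra |].
    (* Needed for an angle strictly below [2 * PI]: [acos c = 0] would give [c = 1] and [y = 0],
       against [y < 0]. *)
    assert (acos c <> 0); [| lra].
    intros E. assert (c = 1) by (rewrite <- (cos_acos c), E, cos_0 by exact Hc1; reflexivity).
    subst c. rewrite H in Hy. nra.
  + unfold polar. rewrite cos_minus, sin_minus, cos_2PI, sin_2PI, cos_acos, sin_acos by exact Hc1.
    rewrite Rabs_left in Hys by lra. f_equal; lra.
Qed.

(** Substituting [r = t s] absorbs the factor [t] of [z = t e^(i theta)]; the unimodular factor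
    comes out of the integral and does not affect the modulus. *)
Lemma Tg_value_polar (dg f : Cx -> Cx) (t theta J1 J2 : R) :
  is_RInt (fun r => fst (Cmul (f (polar r theta)) (dg (polar r theta)))) 0 t J1 ->
  is_RInt (fun r => snd (Cmul (f (polar r theta)) (dg (polar r theta)))) 0 t J2 ->
  Tg_value dg f (polar t theta) (Cmul (J1, J2) (polar 1 theta)).
Proof.
intros H1 H2.
assert (Sub : forall (u : R -> R) J, is_RInt u 0 t J ->
  is_RInt (fun s => t * u (t * s)) 0 1 J).
{ intros u J H.
  assert (H' : is_RInt u (t * 0 + 0) (t * 1 + 0) J)
    by (replace (t * 0 + 0) with 0 by ring; replace (t * 1 + 0) with t by ring; exact H).
  apply (is_RInt_ext (fun s => scal t (u (t * s + 0)))).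
  - intros x _. rewrite Rplus_0_r. reflexivity.
  - exact (is_RInt_comp_lin (V := R_NormedModule) u t 0 0 1 J H'). }
apply Sub in H1. apply Sub in H2.
assert (Ep : forall s, Cscal s (polar t theta) = polar (t * s) theta)
  by (intros s; unfold Cscal, polar; simpl; f_equal; ring).
assert (Lin : forall (u v : R -> R) (I J a b : R), is_RInt u 0 1 I -> is_RInt v 0 1 J ->
  is_RInt (fun s => a * u s + b * v s) 0 1 (a * I + b * J)).
{ intros u v I J a b Hu Hv.
  exact (is_RInt_plus (V := R_NormedModule) _ _ _ _ _ _
    (is_RInt_scal (V := R_NormedModule) _ _ _ a _ Hu)
    (is_RInt_scal (V := R_NormedModule) _ _ _ b _ Hv)). }
split; apply integral_eq_is_RInt.
- assert (H := Lin _ _ _ _ (cos theta) (- sin theta) H1 H2).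
  replace (Cre (Cmul (J1, J2) (polar 1 theta))) with (cos theta * J1 + - sin theta * J2)
    by (unfold Cre, Cmul, polar; simpl; ring).
  eapply is_RInt_ext; [| exact H]. intros s _. rewrite Ep.
  unfold Cre, Cmul, polar; simpl; ring.
- assert (H := Lin _ _ _ _ (sin theta) (cos theta) H1 H2).
  replace (Cim (Cmul (J1, J2) (polar 1 theta))) with (sin theta * J1 + cos theta * J2)
    by (unfold Cim, Cmul, polar; simpl; ring).
  eapply is_RInt_ext; [| exact H]. intros s _. rewrite Ep.
  unfold Cim, Cmul, polar; simpl; ring.
Qed.

Lemma Tg_value_unique (dg f : Cx -> Cx) (z w w' : Cx) :
  Tg_value dg f z w -> Tg_value dg f z w' -> w = w'.
Proof.
assert (U : forall f a b I J, integral_eq f a b I -> integral_eq f a b J -> I = J).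
{ intros u a b I J; rewrite !integral_eq_is_RInt; intros H H'.
  rewrite <- (is_RInt_unique _ _ _ _ H). exact (is_RInt_unique _ _ _ _ H'). }
intros [H1 H2] [H1' H2'].
assert (E1 := U _ _ _ _ _ H1 H1'). assert (E2 := U _ _ _ _ _ H2 H2').
destruct w, w'; simpl in *; congruence.
Qed.

(** On the disk [dg] equals [Cexp (h z)], which is differentiable and hence continuous along the
    radius; integrability follows without a regularity theorem for [g']. *)
Lemma ex_RInt_polar (h f dg : Cx -> Cx) (t theta : R) :
  holoD h -> (forall z, inD z -> Cexp (h z) = dg z) -> holoD f -> 0 <= t < 1 ->
  (exists J1 : R, is_RInt (fun r => fst (Cmul (f (polar r theta)) (dg (polar r theta)))) 0 t J1) /\
  (exists J2 : R, is_RInt (fun r => snd (Cmul (f (polar r theta)) (dg (polar r theta)))) 0 t J2).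
Proof.
intros Hh Hexp Hf Ht.
assert (HF := holoD_mul _ _ Hf (holoD_exp h Hh)).
assert (P : forall p : Cx -> R,
  (forall r, 0 <= r < 1 ->
     continuous (fun s => p (Cmul (f (polar s theta)) (Cexp (h (polar s theta))))) r) ->
  ex_RInt (fun r => p (Cmul (f (polar r theta)) (dg (polar r theta)))) 0 t).
{ intros p Hp.
  apply (ex_RInt_ext (fun r => p (Cmul (f (polar r theta)) (Cexp (h (polar r theta)))))).
  - rewrite Rmin_left, Rmax_right by lra. intros r Hr.
    rewrite Hexp; [reflexivity | apply polar_inD; lra].
  - apply (ex_RInt_continuous (V := R_CompleteNormedModule)).
    rewrite Rmin_left, Rmax_right by lra. intros r Hr. apply Hp; lra. }
split; apply P; intros r Hr; apply (continuous_polar _ r theta HF Hr).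
Qed.

Lemma ex_RInt_weight (h dg : Cx -> Cx) (alpha a b theta : R) :
  holoD h -> (forall z, inD z -> Cexp (h z) = dg z) -> 0 <= a <= b -> b < 1 ->
  exists I : R, is_RInt (fun r => Cmod (dg (polar r theta)) / Rpower (1 - r ^ 2) alpha) a b I.
Proof.
intros Hh Hexp Hab Hb.
apply (ex_RInt_ext (fun r => exp (fst (h (polar r theta))) * exp (- (alpha * ln (1 - r ^ 2))))).
- rewrite Rmin_left, Rmax_right by lra. intros r Hr.
  rewrite <- Hexp, Cmod_Cexp by (apply polar_inD; lra).
  unfold Rpower, Rdiv; rewrite exp_Ropp; reflexivity.
- apply (ex_RInt_continuous (V := R_CompleteNormedModule)).
  rewrite Rmin_left, Rmax_right by lra. intros r Hr.
  apply (continuous_mult (K := R_AbsRing)).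
  + apply (continuous_comp (fun r => fst (h (polar r theta))) exp).
    * apply (continuous_polar h r theta Hh); lra.
    * apply (ex_derive_continuous (V := R_NormedModule)); auto_derive; exact I.
  + apply (ex_derive_continuous (V := R_NormedModule)). auto_derive. nra.
Qed.

(** The radial derivative of [Im h] is at most [B / (1 - c^2) <= 2 L / (1 - c^2) = L hyp'(c)]. The
    mean value theorem for [L hyp - Im h] and [L hyp + Im h] turns this into the Lipschitz bound. *)
Lemma Bloch_lipschitz (h dh : Cx -> Cx) (B L theta : R) :
  is_deriv_on_D h dh ->
  (forall z, inD z -> (1 - Cmod z ^ 2) * Cmod (dh z) <= B) -> B <= 2 * L ->
  forall r r', 0 <= r < 1 -> 0 <= r' < 1 ->
  Rabs (snd (h (polar r theta)) - snd (h (polar r' theta))) <= L * Rabs (hyp r - hyp r').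
Proof.
intros Hh HB HL.
assert (Main : forall r r', 0 <= r < 1 -> r < r' < 1 ->
  Rabs (snd (h (polar r theta)) - snd (h (polar r' theta))) <= L * (hyp r' - hyp r)).
{ intros r r' Hr Hr'.
  set (psi' := fun c => snd (Cmul (dh (polar c theta)) (polar 1 theta))).
  assert (Hpsi : forall c, r <= c <= r' ->
    derivable_pt_lim (fun s => snd (h (polar s theta))) c (psi' c)).
  { intros c Hc. apply is_derive_Reals.
    apply (is_derive_polar h c theta), Hh, polar_inD; lra. }
  assert (Hhyp : forall c, r <= c <= r' ->
    derivable_pt_lim (fun s => L * hyp s) c (L * (2 / (1 - c ^ 2)))).
  { intros c Hc. apply is_derive_Reals. unfold hyp. auto_derive; [lra |].
    field; repeat split; nra. }
  assert (Hb : forall c, r <= c <= r' -> Rabs (psi' c) <= L * (2 / (1 - c ^ 2))).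
  { intros c Hc.
    assert (HD : inD (polar c theta)) by (apply polar_inD; lra).
    specialize (HB _ HD). rewrite Cmod_polar in HB by lra.
    assert (H1 : Rabs (psi' c) <= Cmod (dh (polar c theta))).
    { eapply Rle_trans; [apply snd_le_Cmod |].
      rewrite Cmod_Cmul_polar. apply Rle_refl. }
    assert (H2 : 0 < 1 - c ^ 2) by nra.
    eapply Rle_trans; [exact H1 |].
    replace (L * (2 / (1 - c ^ 2))) with (2 * L / (1 - c ^ 2)) by (field; lra).
    apply Rle_div_r; [exact H2 |]. lra. }
  destruct (MVT_cor2 (fun s => L * hyp s - snd (h (polar s theta)))
    (fun c => L * (2 / (1 - c ^ 2)) - psi' c) r r') as [c [E1 Hc1]]; [lra | |].
  { intros c Hc. apply derivable_pt_lim_minus; auto. }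
  destruct (MVT_cor2 (fun s => L * hyp s + snd (h (polar s theta)))
    (fun c => L * (2 / (1 - c ^ 2)) + psi' c) r r') as [c' [E2 Hc2]]; [lra | |].
  { intros c' Hc'. apply derivable_pt_lim_plus; auto. }
  assert (A1 := Hb c ltac:(lra)). assert (A2 := Hb c' ltac:(lra)).
  apply Rabs_le_between in A1. apply Rabs_le_between in A2.
  apply Rabs_le. split; nra. }
intros r r' Hr Hr'.
destruct (Rtotal_order r r') as [H | [-> | H]].
- rewrite (Rabs_minus_sym (hyp r)). eapply Rle_trans; [apply Main; lra |].
  assert (G := hyp_incr r r' ltac:(lra) ltac:(lra)).
  rewrite Rabs_pos_eq by lra. lra.
- rewrite !Rminus_diag, Rabs_R0. lra.
- rewrite Rabs_minus_sym. eapply Rle_trans; [apply Main; lra |].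
  assert (G := hyp_incr r' r ltac:(lra) ltac:(lra)).
  rewrite Rabs_pos_eq by lra. lra.
Qed.

(** * The two implications *)

Lemma Tg_bounded_of_limsup (dg h : Cx -> Cx) (alpha beta : R) :
  0 <= beta -> holoD h -> (forall z, inD z -> Cexp (h z) = dg z) ->
  limsup_cond dg alpha beta -> Tg_bounded dg alpha beta.
Proof.
intros Hb Hh Hexp [M0 [t0 [Ht0 Hlim]]].
(* The hypothesis speaks only of radii beyond [t0]. The radius [tm] is admissible and controls all
   [t <= t0], because the integral increases with its upper limit. *)
set (tm := (1 + t0) / 2).
assert (Htm : t0 < tm < 1) by (unfold tm; lra).
set (rho := Rpower (1 - tm ^ 2) beta).
assert (Hrho : 0 < rho) by apply exp_pos.
assert (A0 := Rabs_pos M0). assert (Ale := Rle_abs M0).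
assert (Ar : 0 <= Rabs M0 / rho) by (apply Rdiv_le_0_compat; assumption).
(* The first summand serves [t > t0], the second [t <= t0]. *)
exists (Rabs M0 + Rabs M0 / rho); split; [lra |].
intros f M Hf HM z w Hz Hw.
destruct (polar_decomp z) as [theta [Hth Ez]].
assert (m0 : 0 <= Cmod z) by exact (Cmod_nonneg z).
set (t := Cmod z) in *. assert (Ht : 0 <= t < 1) by (split; [exact m0 | exact Hz]).
assert (HM0 : 0 <= M).
{ eapply Rle_trans; [| exact (HM z Hz)].
  apply Rmult_le_pos; [apply Rlt_le, exp_pos | apply Cmod_nonneg]. }
destruct (ex_RInt_polar h f dg t theta Hh Hexp Hf Ht) as [[J1 HJ1] [J2 HJ2]].
destruct (ex_RInt_weight h dg alpha 0 t theta Hh Hexp ltac:(lra) ltac:(lra)) as [I HI].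
assert (Ew : Cmod w = Cmod (J1, J2)).
{ rewrite Ez in Hw.
  rewrite (Tg_value_unique _ _ _ _ _ Hw (Tg_value_polar dg f t theta J1 J2 HJ1 HJ2)).
  apply Cmod_Cmul_polar. }
assert (HJ : Cmod (J1, J2) <= M * I).
{ assert (P0 : 0 <= Cmod (J1, J2)) by apply Cmod_nonneg.
  assert (P2 := Cmod_sqr (J1, J2)). simpl fst in P2; simpl snd in P2.
  set (c := Cmod (J1, J2)) in *.
  (* With [J = (J1, J2)] and [F = f g'], the integral of [Re (conj J * F)] is [|J|^2]. Bounding the
     integrand by [|J| |F|] and cancelling one [|J|] yields the triangle inequality for the complex
     integral. *)
  assert (HL : is_RInt (fun r =>
      J1 * fst (Cmul (f (polar r theta)) (dg (polar r theta)))
    + J2 * snd (Cmul (f (polar r theta)) (dg (polar r theta)))) 0 t (J1 * J1 + J2 * J2)).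
  { exact (is_RInt_plus (V := R_NormedModule) _ _ _ _ _ _
      (is_RInt_scal (V := R_NormedModule) _ _ _ J1 _ HJ1)
      (is_RInt_scal (V := R_NormedModule) _ _ _ J2 _ HJ2)). }
  assert (HR : is_RInt (fun r => (c * M) * (Cmod (dg (polar r theta)) / Rpower (1 - r ^ 2) alpha))
    0 t ((c * M) * I)) by exact (is_RInt_scal (V := R_NormedModule) _ _ _ (c * M) _ HI).
  assert (HLR := is_RInt_le _ _ 0 t _ _ ltac:(lra) HL HR).
  cut (J1 * J1 + J2 * J2 <= c * M * I).
  { intros Q. destruct (Req_dec c 0) as [E | E].
    - rewrite E. apply Rmult_le_pos; [exact HM0 |].
      apply (is_RInt_nonneg _ 0 t I ltac:(lra) HI).
      intros r Hr. apply Rdiv_le_0_compat; [apply Cmod_nonneg | apply exp_pos].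
    - nra. }
  apply HLR. intros r Hr.
  set (p := f (polar r theta)). set (q := dg (polar r theta)).
  assert (HD : inD (polar r theta)) by (apply polar_inD; lra).
  assert (Hf' := HM _ HD). unfold wgt in Hf'. rewrite Cmod_polar in Hf' by lra. fold p in Hf'.
  assert (W : 0 < Rpower (1 - r ^ 2) alpha) by apply exp_pos.
  assert (Q0 : 0 <= Cmod q) by apply Cmod_nonneg.
  assert (Pq : Cmod (Cmul p q) = Cmod p * Cmod q) by apply Cmod_Cmul.
  apply Rle_trans with (c * Cmod (Cmul p q)).
  - (* Cauchy-Schwarz, through |Re (conj J * F)| <= |J| |F| *)
    assert (CS := Rle_abs (fst (Cmul (J1, - J2) (Cmul p q)))).
    assert (CS1 : Rabs (fst (Cmul (J1, - J2) (Cmul p q))) <= Cmod (Cmul (J1, - J2) (Cmul p q)))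
      by apply fst_le_Cmod.
    assert (CS2 : Cmod (Cmul (J1, - J2) (Cmul p q)) = Cmod (J1, - J2) * Cmod (Cmul p q))
      by apply Cmod_Cmul.
    assert (CS3 : Cmod (J1, - J2) = c) by exact (Cmod_conj (J1, J2)).
    rewrite CS2, CS3 in CS1.
    replace (J1 * fst (Cmul p q) + J2 * snd (Cmul p q))
      with (fst (Cmul (J1, - J2) (Cmul p q))) by (unfold Cmul; simpl; ring).
    lra.
  - rewrite Pq, Rmult_assoc. apply Rmult_le_compat_l; [exact P0 |].
    replace (M * (Cmod q / Rpower (1 - r ^ 2) alpha))
      with (M / Rpower (1 - r ^ 2) alpha * Cmod q) by (field; lra).
    apply Rmult_le_compat_r; [exact Q0 |]. apply Rle_div_r; [exact W | lra]. }
assert (Hwt : wgt beta z = Rpower (1 - t ^ 2) beta) by reflexivity.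
rewrite Hwt, Ew.
assert (W0 : 0 < Rpower (1 - t ^ 2) beta) by apply exp_pos.
destruct (Rlt_dec t0 t) as [C | C].
- assert (H := Hlim t theta ltac:(lra) Hth I (proj2 (integral_eq_is_RInt _ _ _ _) HI)).
  apply Rle_trans with (M * (Rpower (1 - t ^ 2) beta * I)).
  + replace (M * (Rpower (1 - t ^ 2) beta * I)) with (Rpower (1 - t ^ 2) beta * (M * I)) by ring.
    apply Rmult_le_compat_l; lra.
  + rewrite Rmult_comm. apply Rmult_le_compat_r; lra.
(* For [t <= t0], adding the nonnegative integral over [[t, tm]] gives [I <= |M0| / rho], and the
   weight at [t] is at most 1 since [beta >= 0]. *)
- destruct (ex_RInt_weight h dg alpha t tm theta Hh Hexp ltac:(lra) ltac:(lra)) as [I' HI'].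
  assert (P' : 0 <= I').
  { apply (is_RInt_nonneg _ t tm I' ltac:(lra) HI').
    intros r Hr. apply Rdiv_le_0_compat; [apply Cmod_nonneg | apply exp_pos]. }
  assert (HS := is_RInt_Chasles (V := R_NormedModule) _ _ _ _ _ _ HI HI').
  assert (H := Hlim tm theta ltac:(lra) Hth _ (proj2 (integral_eq_is_RInt _ _ _ _) HS)).
  fold rho in H. change (plus I I') with (I + I') in H.
  assert (HI2 : I <= Rabs M0 / rho) by (apply Rle_div_r; [exact Hrho | nra]).
  assert (W1 : Rpower (1 - t ^ 2) beta <= 1).
  { unfold Rpower. rewrite <- exp_0 at 2. apply exp_le.
    assert (ln (1 - t ^ 2) <= ln 1) by (apply ln_le; nra). rewrite ln_1 in *. nra. }
  assert (0 <= Cmod (J1, J2)) by apply Cmod_nonneg.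
  apply Rle_trans with (1 * (M * I)); [apply Rmult_le_compat; lra |]. nra.
Qed.

Lemma limsup_of_Tg_bounded (dg h : Cx -> Cx) (alpha beta : R) :
  0 <= alpha -> holoD h -> (forall z, inD z -> Cexp (h z) = dg z) -> in_Bloch h ->
  Tg_bounded dg alpha beta -> limsup_cond dg alpha beta.
Proof.
intros Ha Hh Hexp [dh [Hdh [B HB]]] [K [HK HT]].
(* Chosen positive, as the mesh [1 / L] requires, and with [B <= 2 * L]. *)
set (L := Rabs B + 1).
assert (HL : 0 < L /\ B <= 2 * L).
{ assert (A := Rle_abs B); assert (A' := Rabs_pos B); unfold L; lra. }
set (Mf := exp (alpha * ln 2 + 8 * (L * PI) ^ 2) * (3 * PI)).
assert (Pc := test_const_pos).
(* The estimate holds at every radius in [(0, 1)], so [t0 = 0] works; [Mf] bounds the norms of all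
   the test functions, whatever [t] and [theta]. *)
exists (K * Mf / test_const), 0; split; [lra |].
intros t theta Ht Hth I HI. apply integral_eq_is_RInt in HI.
destruct (test_function alpha L theta t (fun r => snd (h (polar r theta))) Ha (proj1 HL) ltac:(lra)
  (Bloch_lipschitz h dh B L theta Hdh HB (proj2 HL))) as [f [Hf [HfM Hrad]]].
destruct (ex_RInt_polar h f dg t theta Hh Hexp Hf ltac:(lra)) as [[J1 HJ1] [J2 HJ2]].
assert (HD : inD (polar t theta)) by (apply polar_inD; lra).
assert (H := HT f Mf Hf HfM _ _ HD (Tg_value_polar dg f t theta J1 J2 HJ1 HJ2)).
rewrite Cmod_Cmul_polar in H. unfold wgt in H. rewrite Cmod_polar in H by lra.
(* [g'] has phase [exp(i Im h)], which the test function nearly cancels, so [Re (f g')] dominates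
   [test_const] times the weighted integrand pointwise. *)
assert (HJ : test_const * I <= J1).
{ apply (is_RInt_le _ _ 0 t _ _ ltac:(lra)
    (is_RInt_scal (V := R_NormedModule) _ _ _ test_const _ HI) HJ1).
  intros r Hr. change (test_const * (Cmod (dg (polar r theta)) / Rpower (1 - r ^ 2) alpha)
    <= fst (Cmul (f (polar r theta)) (dg (polar r theta)))).
  specialize (Hrad r ltac:(lra)).
  rewrite <- (Hexp (polar r theta)) by (apply polar_inD; lra).
  rewrite Cmod_Cexp. set (p := h (polar r theta)) in *. set (q := f (polar r theta)) in *.
  assert (Pe := exp_pos (fst p)).
  replace (fst (Cmul q (Cexp p))) with (fst (Cmul q (cos (snd p), sin (snd p))) * exp (fst p))
    by (unfold Cmul, Cexp; simpl; ring).
  replace (test_const * (exp (fst p) / Rpower (1 - r ^ 2) alpha))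
    with (test_const / Rpower (1 - r ^ 2) alpha * exp (fst p)) by (unfold Rdiv; ring).
  apply Rmult_le_compat_r; lra. }
assert (H1 : Rabs J1 <= Cmod (J1, J2)) by exact (fst_le_Cmod (J1, J2)).
assert (H2 := Rle_abs J1).
apply (proj1 (Rle_div_r _ _ _ Pc)).
assert (W : 0 < Rpower (1 - t ^ 2) beta) by apply exp_pos.
apply Rle_trans with (2 := H).
rewrite Rmult_assoc. apply Rmult_le_compat_l; lra.
Qed.

Theorem theorem1 (alpha beta : R) (g dg : Cx -> Cx) :
  0 <= alpha -> 0 <= beta ->
  is_deriv_on_D g dg ->
  (forall z : Cx, inD z -> dg z <> C0) ->
  (exists h : Cx -> Cx, holoD h /\ (forall z : Cx, inD z -> Cexp (h z) = dg z) /\ in_Bloch h) ->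
  (Tg_bounded dg alpha beta <-> limsup_cond dg alpha beta).
Proof.
intros Ha Hb _ _ [h [Hh [Hexp HB]]]; split.
- exact (limsup_of_Tg_bounded dg h alpha beta Ha Hh Hexp HB).
- exact (Tg_bounded_of_limsup dg h alpha beta Hb Hh Hexp).
Qed.
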